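(* Let $\Gamma$ be a finite simplicial graph which is connected, triangle-free and has at least two edges. Let $\phi\in Aut^0(A_\Gamma)$ be a pure automorphism of $A_\Gamma$ and let $J=U * W$ be a maximal join in $\Gamma$. Then $\phi$ maps $A_J=F\langle U\rangle\times F\langle W\rangle$ to a conjugate of itself (in $A_\Gamma$). Moreover, if $U$ contains no leaves of $\Gamma$, then $\phi$ preserves the factor $F\langle U\rangle$ up to conjugacy, i.e. $\phi(F\langle U\rangle)$ is conjugate to $F\langle U\rangle$ in $A_\Gamma$.
   Context: $V$ is the vertex set of $\Gamma$ and $A_\Gamma=\langle V \mid vw=wv \text{ if } v,w \text{ are joined by an edge of } \Gamma\rangle$ is the right-angled Artin group. For a full subgraph $\Theta$, $A_\Theta$ denotes the subgroup of $A_\Gamma$ generated by the vertices of $\Theta$. $lk(v)$ is the set of vertices adjacent to $v$ and $st(v)=lk(v)\cup\{v\}$. A leaf is a vertex of valence one in $\Gamma$. A join $J=U*W$ in $\Gamma$ is a complete bipartite subgraph on two disjoint nonempty sets of vertices $U,W$ (every vertex of $U$ is adjacent to every vertex of $W$); it is maximal if it is not properly contained in another join subgraph of $\Gamma$. Since $\Gamma$ is triangle-free, $A_J=F\langle U\rangle\times F\langle W\rangle$, where $F\langle S\rangle$ denotes the free group on $S$. The pure automorphism group $Aut^0(A_\Gamma)$ is the subgroup of $Aut(A_\Gamma)$ generated by: inner automorphisms; inversions (sending one generator $v$ to $v^{-1}$ and fixing the others); partial conjugations (for a vertex $v$ and a connected component $C$ of $\Gamma-st(v)$, conjugate all generators in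 $C$ by $v$ and fix the others); and transvections (for distinct vertices $v,w$ with $lk(w)\subseteq st(v)$, send $w\mapsto wv$ and fix the other generators). *)

(* Defs.v *)
From HB Require Import structures.
From mathcomp Require Import all_boot.
From mathcomp Require Import boolp classical_sets.

Set Implicit Arguments.
Unset Strict Implicit.
Unset Printing Implicit Defensive.

Local Open Scope group_scope.

Record sgraph := SGraph {
  vert :> finType;
  adj : rel vert;
  adj_sym : symmetric adj;
  adj_irr : irreflexive adj
}.

Section Graphs.
Variable G : sgraph.
Implicit Types (u v w x y z : G) (U W C D : {set G}).

Definition edges : {set {set G}} :=
  [set [set p.1; p.2] | p : G * G & adj p.1 p.2]%SET.

Definition connected_graph : Prop := forall x y, connect (@adj G) x y.

Definition triangle_free : Prop :=
  forall x y z, ~~ [&& adj x y, adj y z & adj z x].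

Definition lk v : {set G} := [set w | adj v w]%SET.
Definition st v : {set G} := v |: lk v.

Definition leaf v : bool := #|lk v| == 1%N.

(* [C] is a connected component of the full subgraph spanned by [D]. *)
Definition component D C : Prop :=
  exists2 x, x \in D &
    C = [set y | connect [rel a b | [&& a \in D, b \in D & adj a b]] x y]%SET.

Definition join U W : Prop :=
  [/\ U != finset.set0, W != finset.set0, [disjoint U & W]
    & {in U & W, forall u w, adj u w}].

(* The complete bipartite subgraph U * W, as (vertices, edges). *)
Definition join_graph U W : {set G} * {set {set G}} :=
  (U :|: W, [set [set u; w] | u in U, w in W]%SET).

Definition subgraph (H K : {set G} * {set {set G}}) : bool :=
  (H.1 \subset K.1) && (H.2 \subset K.2).

Definition maximal_join U W : Prop :=
  join U W /\
  forall U' W', join U' W' ->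
    subgraph (join_graph U W) (join_graph U' W') ->
    join_graph U' W' = join_graph U W.

End Graphs.

Section Subgroups.
Variable A : groupType.
Local Open Scope classical_set_scope.
Implicit Types (S H K : set A).

Definition is_subgroup H : Prop :=
  [/\ H 1, forall x y, H x -> H y -> H (x * y) & forall x, H x -> H x^-1].

Definition generated S : set A :=
  \bigcap_(H in [set H | is_subgroup H /\ S `<=` H]) H.

Definition conjugate_sets H K : Prop := exists g : A, K = (conjg^~ g) @` H.

End Subgroups.

(* The group law on [aut A], given below, is composition of functions. *)
Record aut (A : groupType) := Aut {
  aut_fun :> A -> A;
  aut_morph : {morph aut_fun : x y / x * y};
  aut_bij : bijective aut_fun
}.

HB.instance Definition _ (A : groupType) := gen_eqMixin (aut A).
HB.instance Definition _ (A : groupType) := gen_choiceMixin (aut A).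

Section AutGroup.
Variable A : groupType.
Implicit Types f g h : aut A.

Lemma autP f g : f =1 g -> f = g.
Proof.
case: f g => [f fM fB] [g gM gB] /= /funext fg; rewrite fg in fM fB *.
by congr Aut; apply: Prop_irrelevance.
Qed.

Definition aut1 : aut A :=
  @Aut A idfun (fun _ _ => erefl) (Bijective (frefl idfun) (frefl idfun)).

Lemma aut_mul_morph f g : {morph f \o g : x y / x * y}.
Proof. by move=> x y /=; rewrite !aut_morph. Qed.

Definition aut_mul f g : aut A :=
  Aut (aut_mul_morph f g) (bij_comp (aut_bij f) (aut_bij g)).

Lemma aut_inv_subproof f : exists g : aut A, cancel g f /\ cancel f g.
Proof.
have [g fK gK] := aut_bij f.
have gM : {morph g : x y / x * y}.
  by move=> x y; apply: (can_inj fK); rewrite aut_morph !gK.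
by exists (Aut gM (Bijective gK fK)).
Qed.

Definition aut_inv f : aut A := projT1 (cid (aut_inv_subproof f)).

Lemma aut_invK f : cancel f (aut_inv f).
Proof. by rewrite /aut_inv; case: cid => g []. Qed.

Lemma autK f : cancel (aut_inv f) f.
Proof. by rewrite /aut_inv; case: cid => g []. Qed.

Lemma aut_mulA : associative aut_mul.
Proof. by move=> f g h; apply: autP. Qed.
Lemma aut_mul1 : left_id aut1 aut_mul.
Proof. by move=> f; apply: autP. Qed.
Lemma aut_mulr1 : right_id aut1 aut_mul.
Proof. by move=> f; apply: autP. Qed.
Lemma aut_mulV : left_inverse aut1 aut_inv aut_mul.
Proof. by move=> f; apply: autP => x; apply: aut_invK. Qed.
Lemma aut_mulrV : right_inverse aut1 aut_inv aut_mul.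
Proof. by move=> f; apply: autP => x; apply: autK. Qed.

HB.instance Definition _ := isGroup.Build (aut A)
  aut_mulA aut_mul1 aut_mulr1 aut_mulV aut_mulrV.

End AutGroup.

(* The letter [(v, false)] stands for v and [(v, true)] for v^-1. *)
Definition word (G : sgraph) := seq (G * bool).

HB.instance Definition _ (G : sgraph) := Choice.on (word G).

Section RAAG.
Variable G : sgraph.
Implicit Types (s t p q : word G) (v w : G).

Definition inv_letter (a : G * bool) : G * bool := (a.1, ~~ a.2).
Definition inv_word s : word G := rev (map inv_letter s).

Inductive word_eq : word G -> word G -> Prop :=
| word_eq_cancel p a q : word_eq (p ++ [:: a; inv_letter a] ++ q) (p ++ q)
| word_eq_comm p v w q : adj v w ->
    word_eq (p ++ [:: (v, false); (w, false)] ++ q)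
            (p ++ [:: (w, false); (v, false)] ++ q)
| word_eq_refl s : word_eq s s
| word_eq_sym s t : word_eq s t -> word_eq t s
| word_eq_trans s t p : word_eq s t -> word_eq t p -> word_eq s p.

Definition word_eqb : rel (word G) := fun s t => `[< word_eq s t >].

Lemma word_eqb_refl : reflexive word_eqb.
Proof. by move=> s; apply/asboolP; apply: word_eq_refl. Qed.
Lemma word_eqb_sym : symmetric word_eqb.
Proof. by move=> s t; apply/asboolP/asboolP; apply: word_eq_sym. Qed.
Lemma word_eqb_trans : transitive word_eqb.
Proof.
move=> t s p /asboolP st /asboolP tp.
by apply/asboolP; apply: word_eq_trans st tp.
Qed.

Canonical word_equiv :=
  EquivRel word_eqb word_eqb_refl word_eqb_sym word_eqb_trans.

Definition raag := {eq_quot word_equiv}%qT.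

HB.instance Definition _ := Choice.on raag.
HB.instance Definition _ := EqQuotient.on raag.

Definition raag_class s : raag := (\pi_raag s)%qT.

Lemma raag_classP s t : raag_class s = raag_class t <-> word_eq s t.
Proof.
split; first by move=> /eqP; rewrite /raag_class piE => /asboolP.
by move=> st; apply/eqP; rewrite /raag_class piE; apply/asboolP.
Qed.

Lemma raag_ind (P : raag -> Prop) :
  (forall s, P (raag_class s)) -> forall x, P x.
Proof. by move=> Ps x; rewrite -[x]reprK; apply: Ps. Qed.

Lemma word_eq_repr s : word_eq (repr (raag_class s)) s.
Proof. by apply/raag_classP; rewrite /raag_class reprK. Qed.

Lemma word_eq_ctx p s t q : word_eq s t -> word_eq (p ++ s ++ q) (p ++ t ++ q).
Proof.
elim=> {s t} [p' a q'|p' v w q' vw|s|s t _|s t r _ st _ tr].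
- by have := word_eq_cancel (p ++ p') a (q' ++ q); rewrite /= -!catA.
- by have := word_eq_comm (p ++ p') (q' ++ q) vw; rewrite /= -!catA.
- exact: word_eq_refl.
- exact: word_eq_sym.
- exact: word_eq_trans st tr.
Qed.

Lemma word_eq_cat s s' t t' :
  word_eq s s' -> word_eq t t' -> word_eq (s ++ t) (s' ++ t').
Proof.
move=> ss tt; apply: (@word_eq_trans _ (s' ++ t)).
  exact: (@word_eq_ctx [::] s s' t).
by have := @word_eq_ctx s' t t' [::] tt; rewrite !cats0.
Qed.

Lemma inv_letterK : involutive inv_letter.
Proof. by move=> [v b]; rewrite /inv_letter /= negbK. Qed.

Lemma inv_wordK : involutive inv_word.
Proof. by move=> s; rewrite /inv_word map_rev revK mapK //; apply: inv_letterK. Qed.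

Lemma word_eq_mulV s : word_eq (s ++ inv_word s) [::].
Proof.
elim: s => [|a s IHs]; first exact: word_eq_refl.
rewrite /inv_word /= rev_cons -cats1.
apply: (@word_eq_trans _ [:: a; inv_letter a]).
  by have := @word_eq_ctx [:: a] _ _ [:: inv_letter a] IHs; rewrite /= -catA.
exact: (@word_eq_cancel [::] a [::]).
Qed.

Lemma word_eq_mulVl s : word_eq (inv_word s ++ s) [::].
Proof. by have := word_eq_mulV (inv_word s); rewrite inv_wordK. Qed.

Lemma word_eq_inv s t : word_eq s t -> word_eq (inv_word s) (inv_word t).
Proof.
move=> st; apply: (@word_eq_trans _ (inv_word s ++ (t ++ inv_word t))).
  apply: word_eq_sym; rewrite -[X in word_eq _ X]cats0.
  by apply: word_eq_cat (word_eq_mulV t); apply: word_eq_refl.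
rewrite catA -[X in word_eq _ X]cat0s.
apply: word_eq_cat; last exact: word_eq_refl.
apply: word_eq_trans (word_eq_mulVl s).
by apply: word_eq_cat (word_eq_sym st); apply: word_eq_refl.
Qed.

Definition raag1 : raag := raag_class [::].
Definition raag_mul (x y : raag) : raag := raag_class (repr x ++ repr y).
Definition raag_inv (x : raag) : raag := raag_class (inv_word (repr x)).

Lemma raag_mulE s t :
  raag_mul (raag_class s) (raag_class t) = raag_class (s ++ t).
Proof. by apply/raag_classP/word_eq_cat; apply: word_eq_repr. Qed.

Lemma raag_invE s : raag_inv (raag_class s) = raag_class (inv_word s).
Proof. by apply/raag_classP/word_eq_inv/word_eq_repr. Qed.

Lemma raag_mulA : associative raag_mul.
Proof.
elim/raag_ind=> s; elim/raag_ind=> t; elim/raag_ind=> p.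
by rewrite !raag_mulE catA.
Qed.
Lemma raag_mul1 : left_id raag1 raag_mul.
Proof. by elim/raag_ind=> s; rewrite raag_mulE. Qed.
Lemma raag_mulr1 : right_id raag1 raag_mul.
Proof. by elim/raag_ind=> s; rewrite raag_mulE cats0. Qed.
Lemma raag_mulV : left_inverse raag1 raag_inv raag_mul.
Proof.
elim/raag_ind=> s; rewrite raag_invE raag_mulE.
exact/raag_classP/word_eq_mulVl.
Qed.
Lemma raag_mulrV : right_inverse raag1 raag_inv raag_mul.
Proof.
elim/raag_ind=> s; rewrite raag_invE raag_mulE.
exact/raag_classP/word_eq_mulV.
Qed.

HB.instance Definition _ := isGroup.Build raag
  raag_mulA raag_mul1 raag_mulr1 raag_mulV raag_mulrV.

Definition vgen v : raag := raag_class [:: (v, false)].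

(* The subgroup of A_G generated by the vertices in [S].  It is A_Theta when S
   is the vertex set of a full subgraph Theta, and F<S> when S spans no edge. *)
Definition special (S : {set G}) : set raag :=
  generated [set vgen v | v in [set` S]]%classic.

Implicit Types phi : aut raag.

Definition inner phi : Prop := exists g : raag, forall x, phi x = x ^ g.

(* An automorphism is determined by its values on the generators [vgen u], so
   each predicate below singles out one automorphism for each choice of the
   vertices v, w (and of the component C). *)
Definition inversion phi : Prop :=
  exists v, forall u, phi (vgen u) = if u == v then (vgen v)^-1 else vgen u.

Definition partial_conjugation phi : Prop :=
  exists v (C : {set G}), component (~: st v) C /\
    forall u, phi (vgen u) = if u \in C then vgen u ^ vgen v else vgen u.

Definition transvection phi : Prop :=
  exists v w, [/\ v != w, lk w \subset st v &
    forall u, phi (vgen u) = if u == w then vgen w * vgen v else vgen u].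

Definition pure_aut : set (aut raag) :=
  generated [set phi | [\/ inner phi, inversion phi,
                           partial_conjugation phi | transvection phi]]%classic.

End RAAG.

(* Main.v *)
Require Import Defs.
From mathcomp Require Import all_boot.
From mathcomp Require Import boolp classical_sets.

(* The automorphisms preserving a given subset up to conjugacy form a subgroup,
   so it suffices to check generators of the pure automorphism group.  For a
   partial conjugation by a vertex v outside J, maximality forces J - st(v) to
   be connected; since v commutes with J inside lk(v), either all of J is
   conjugated by v or all of J is fixed.  For
   a transvection w |-> wv with w in U, W lies in st(v), so either W lies in
   lk(v) and v is in U by maximality, or v is in W and, there being no
   triangle, lk(w) = {v}, i.e. w is a leaf. *)

Set Implicit Arguments.
Unset Strict Implicit.
Unset Printing Implicit Defensive.

Local Open Scope group_scope.

(** * Automorphisms and the conjugacy of subsets *)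

Section GroupSubsets.
Local Open Scope classical_set_scope.
Variable A : groupType.
Implicit Types (f : aut A) (S H K : set A).

Lemma aut_1 f : f 1 = 1.
Proof. by apply: (mulgI (f 1)); rewrite -aut_morph !mulg1. Qed.

Lemma aut_V f x : f x^-1 = (f x)^-1.
Proof. by apply: (mulgI (f x)); rewrite -aut_morph !mulgV aut_1. Qed.

Lemma aut_J f x y : f (x ^ y) = f x ^ f y.
Proof. by rewrite /conjg !aut_morph aut_V. Qed.

Lemma generated_subgroup S : is_subgroup (generated S).
Proof.
split=> [H [[]] //|x y Sx Sy H HS|x Sx H HS].
- by have [[_ HM _] _] := HS; apply: HM; [apply: Sx | apply: Sy].
- by have [[_ _ HV] _] := HS; apply: HV; apply: Sx.
Qed.

Lemma generated_min S H : is_subgroup H -> S `<=` H -> generated S `<=` H.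
Proof. by move=> sH SH x; apply. Qed.

Lemma is_subgroup_preimage f H : is_subgroup H -> is_subgroup (f @^-1` H).
Proof.
move=> [H1 HM HV]; split=> [|x y|x]; rewrite /preimage /= ?aut_1 //.
  by rewrite aut_morph; apply: HM.
by rewrite aut_V; apply: HV.
Qed.

Lemma is_subgroup_image f H : is_subgroup H -> is_subgroup (f @` H).
Proof.
move=> [H1 HM HV]; split=> [|_ _ [x Hx <-] [y Hy <-]|_ [x Hx <-]].
- by exists 1; rewrite ?aut_1.
- by exists (x * y); rewrite ?aut_morph //; apply: HM.
- by exists x^-1; rewrite ?aut_V //; apply: HV.
Qed.

Lemma conjugate_sets_refl H : conjugate_sets H H.
Proof.
exists 1; apply/seteqP; split=> [x Hx|_ [x Hx <-]]; last by rewrite /= conjg1.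
by exists x; rewrite //= conjg1.
Qed.

Lemma conjugate_sets_sym H K : conjugate_sets H K -> conjugate_sets K H.
Proof.
case=> g ->; exists g^-1; rewrite image_comp.
have -> : conjg^~ g^-1 \o conjg^~ g = id by apply/funext=> x /=; rewrite conjgK.
by rewrite image_id.
Qed.

Lemma conjugate_sets_trans H K L :
  conjugate_sets H K -> conjugate_sets K L -> conjugate_sets H L.
Proof.
case=> g -> [h ->]; exists (g * h); rewrite image_comp.
by congr image; apply/funext=> x /=; rewrite conjgM.
Qed.

Lemma conjugate_sets_image f H K :
  conjugate_sets H K -> conjugate_sets (f @` H) (f @` K).
Proof.
case=> g ->; exists (f g); rewrite !image_comp.
by congr image; apply/funext=> x /=; rewrite aut_J.
Qed.

(** Automorphisms carry conjugate sets to conjugate sets. Applying f to the relation for g, or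
    [f^-1] to the relation for f, gives closure under products and inverses. *)
Lemma is_subgroup_conj_stable H :
  is_subgroup [set f : aut A | conjugate_sets H (f @` H)].
Proof.
split=> [|f g fH gH|f fH] /=.
- by rewrite -[X in conjugate_sets X]image_id; apply: conjugate_sets_refl.
- apply: (conjugate_sets_trans fH).
  by have := conjugate_sets_image f gH; rewrite [X in conjugate_sets _ X]image_comp.
- apply: conjugate_sets_sym.
  have := conjugate_sets_image f^-1 fH.
  rewrite [X in conjugate_sets _ X]image_comp.
  have -> : (f^-1 : aut A) \o f = id by apply/funext=> x; apply: aut_invK.
  by rewrite image_id.
Qed.

End GroupSubsets.

(** * Images of special subgroups, read off from the generators *)

Section Special.
Variable G : sgraph.
Implicit Types (S : {set G}) (phi : aut (raag G)) (u v w : G).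
Local Notation image_set f H := (f @` H)%classic.

Lemma special_subgroup S : is_subgroup (special S).
Proof. exact: generated_subgroup. Qed.

Lemma special_vgen S v : v \in S -> special S (vgen v).
Proof. by move=> Sv H [_]; apply; exists v. Qed.

Lemma special_min S (H : set (raag G)) :
  is_subgroup H -> {in S, forall v, H (vgen v)} -> (special S `<=` H)%classic.
Proof. by move=> sH SH; apply: generated_min => // _ [v Sv <-]; apply: SH. Qed.

(** Each hypothesis yields one inclusion, since both [special S] and its image are subgroups. The
    second one is a real condition: an endomorphic image could be smaller. *)
Lemma special_image_eq S phi :
    {in S, forall u, special S (phi (vgen u))} ->
    {in S, forall u, image_set phi (special S) (vgen u)} ->
  image_set phi (special S) = special S.
Proof.
move=> phiS Sphi; apply/seteqP; split.
  move=> _ [x Sx <-]; move: x Sx.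
  exact: (special_min (is_subgroup_preimage phi (special_subgroup S)) phiS).
exact: (special_min (is_subgroup_image phi (special_subgroup S)) Sphi).
Qed.

Lemma special_conj S phi g :
    {in S, forall u, phi (vgen u) = vgen u ^ g} ->
  conjugate_sets (special S) (image_set phi (special S)).
Proof.
move=> phiS; exists g; apply: eq_imagel => x; move: x.
(* The elements on which [phi] agrees with conjugation by [g] form a subgroup, so agreement on
   generators suffices. *)
apply: (@special_min S [set x | phi x = x ^ g]%classic) => //.
split=> [|x y|x] /=; first by rewrite aut_1 conj1g.
  by rewrite aut_morph conjMg => -> ->.
by rewrite aut_V conjVg => ->.
Qed.

Lemma special_fixed S phi :
    {in S, forall u, phi (vgen u) = vgen u} ->
  conjugate_sets (special S) (image_set phi (special S)).
Proof. by move=> phiS; apply: (@special_conj _ _ 1) => u /phiS; rewrite conjg1. Qed.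

Lemma special_inversion S phi :
  inversion phi -> conjugate_sets (special S) (image_set phi (special S)).
Proof.
case=> v phiE; have [_ _ SV] := special_subgroup S.
have [_ _ IV] := is_subgroup_image phi (special_subgroup S).
have phiS u : u \in S -> special S (phi (vgen u)).
  by rewrite phiE; case: eqP => [->|_] Su; [apply: SV|]; apply: special_vgen.
rewrite special_image_eq //; first exact: conjugate_sets_refl.
move=> u Su; have : image_set phi (special S) (phi (vgen u)).
  by exists (vgen u); first exact: special_vgen.
by rewrite phiE; case: eqP => [->|//] /IV; rewrite invgK.
Qed.

(** Treats partial conjugations and transvections together when the multiplier [v] lies in [S]. As
    [v] is fixed, it belongs to the image, so conjugation or right multiplication by [v] can be
    undone there. *)
Lemma special_multiplier S phi v :
    v \in S -> phi (vgen v) = vgen v ->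
    {in S, forall u, [\/ phi (vgen u) = vgen u, phi (vgen u) = vgen u ^ vgen v
                       | phi (vgen u) = vgen u * vgen v]} ->
  conjugate_sets (special S) (image_set phi (special S)).
Proof.
move=> Sv phiv phiE; have [_ SM SV] := special_subgroup S.
have [_ IM IV] := is_subgroup_image phi (special_subgroup S).
have Sgen u := @special_vgen S u.
have Iv : image_set phi (special S) (vgen v) by exists (vgen v); auto.
rewrite special_image_eq; first exact: conjugate_sets_refl.
  move=> u Su; case: (phiE u Su) => ->; rewrite /conjg; auto.
move=> u Su; have Iu : image_set phi (special S) (phi (vgen u)).
  by exists (vgen u); auto.
case: (phiE u Su) => phiu; rewrite phiu in Iu; first by [].
  by rewrite -(conjgK (vgen v) (vgen u)) /(_ ^ _^-1); auto.
by rewrite -(mulgK (vgen v) (vgen u)); auto.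
Qed.

Lemma vgen_adjJ u v : adj u v -> vgen u ^ vgen v = vgen u.
Proof.
move=> uv; rewrite /conjg; have -> : vgen u * vgen v = vgen v * vgen u.
  rewrite [LHS]raag_mulE [RHS]raag_mulE.
  exact/raag_classP/(@word_eq_comm _ [::] _ _ [::]).
by rewrite mulKg.
Qed.

End Special.

(** * Maximal joins against each kind of generator *)

Section Joins.
Variable G : sgraph.
Implicit Types (U W C S : {set G}) (phi : aut (raag G)) (u v w : G).
Hypothesis Gtf : triangle_free G.

(** Edges are unordered pairs, so [join_graph] does not see the order of the factors. This lets
    facts about one side be used for the other. *)
Lemma maximal_join_sym U W : maximal_join U W -> maximal_join W U.
Proof.
have JC U' W' : join_graph U' W' = join_graph W' U'.
  congr pair; first exact: finset.setUC.
  by apply/setP=> e; apply/imset2P/imset2P => -[x y ? ? ->];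
    exists y x; rewrite // finset.setUC.
case=> -[U0 W0 dUW UW] max; split; last by move=> U' W'; rewrite (JC W U); apply: max.
by split; rewrite // 1?disjoint_sym // => u w Wu Uw; rewrite adj_sym UW.
Qed.

(** Adding [v] to [U] gives a join containing the old one; by maximality the vertex sets agree, and
    irreflexivity keeps [v] out of [W]. *)
Lemma maximal_join_absorb U W v :
  maximal_join U W -> {in W, forall w, adj v w} -> v \in U.
Proof.
case=> [[U0 W0 dUW UW]] max vW.
have vNW : v \notin W by apply/negP=> /vW; rewrite adj_irr.
have J' : join (v |: U) W.
  split=> //; first by apply/finset.set0Pn; exists v; rewrite setU11.
    by rewrite -setI_eq0 finset.setIUl finset.setU_eq0 !setI_eq0 disjoints1 vNW.
  by move=> u w /setU1P[->|Uu] Ww; [apply: vW | apply: UW].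
have sub : subgraph (join_graph U W) (join_graph (v |: U) W).
  rewrite /subgraph /= finset.setSU ?finset.subsetUr //=.
  exact/imset2Sl/finset.subsetUr.
have [/setP/(_ v) + _] := max _ _ J' sub.
by rewrite !inE eqxx (negPf vNW) /= orbF => <-.
Qed.

Lemma component_sub (D C : {set G}) : component D C -> C \subset D.
Proof.
case=> x xD ->; apply/fintype.subsetP=> u; rewrite inE => /connectP[p pth ->].
by elim: p x xD pth => //= y p IHp x xD /andP[/and3P[_ yD _]]; apply: IHp.
Qed.

(** All of [W] and some [u0] in [U] survive the removal of [st v]. What is left of the join is
    complete bipartite with both sides nonempty, hence connected, and lies inside [C] or misses
    it. *)
Lemma partial_conjugation_outside U W v C :
    maximal_join U W -> component (~: st v) C -> v \notin U :|: W ->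
    {in W, forall w, ~~ adj v w} ->
  {in U :|: W, forall u, u \in C \/ adj u v} \/ {in U :|: W, forall u, u \notin C}.
Proof.
move=> J CC vNJ vNW; have CD u := fintype.subsetP (component_sub CC) u.
have {CC}[x xD CE] := CC.
have D_W w : w \in W -> w \in ~: st v.
  move=> Ww; rewrite !inE negb_or vNW // andbT.
  by apply: contraNneq vNJ => <-; rewrite inE Ww orbT.
have [[_ /finset.set0Pn[w0 Ww0] _ UW] _] := J.
(* Otherwise [v] would be adjacent to all of [U] and be absorbed into [W]. *)
have [u0 Uu0 vu0] : exists2 u0, u0 \in U & ~~ adj v u0.
  apply/exists_inP; apply: contraNT vNJ; rewrite negb_exists_in => /forall_inP vU.
  rewrite inE (maximal_join_absorb (maximal_join_sym J)) ?orbT // => u Uu.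
  exact/negbNE/vU.
have D_U u : u \in U -> ~~ adj v u -> u \in ~: st v.
  move=> Uu vu; rewrite !inE negb_or vu andbT.
  by apply: contraNneq vNJ => <-; rewrite inE Uu.
set e := [rel a b | _] in CE.
have esym : connect_sym e.
  by apply: sym_connect_sym => a b; rewrite /= adj_sym andbCA.
have eUW u w : u \in U -> ~~ adj v u -> w \in W -> connect e u w.
  by move=> Uu vu Ww; apply/(@connect1 _ e)/and3P; split;
    [apply: D_U | apply: D_W | apply: UW].
have CW w : w \in W -> (w \in C) = (u0 \in C).
  move=> Ww; rewrite CE !finset.in_set.
  by rewrite (same_connect_r esym (eUW u0 w Uu0 vu0 Ww)).
have CU u : u \in U -> ~~ adj v u -> (u \in C) = (u0 \in C).
  move=> Uu vu; rewrite -(CW w0) // CE !finset.in_set.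
  by rewrite (same_connect_r esym (eUW u w0 Uu vu Ww0)).
have [Cu0|Cu0] := boolP (u0 \in C); [left|right] => u /setUP[Uu|Wu].
- have [vu|vu] := boolP (adj v u); first by rewrite adj_sym vu; right.
  by left; rewrite CU.
- by left; rewrite CW.
- have [vu|vu] := boolP (adj v u); last by rewrite CU.
  by apply/negP => /CD; rewrite !inE vu orbT.
- by rewrite CW.
Qed.

Lemma partial_conjugation_outside_conj U W v C phi :
    maximal_join U W -> component (~: st v) C -> v \notin U :|: W ->
    (forall u, phi (vgen u) = if u \in C then vgen u ^ vgen v else vgen u) ->
  exists g, {in U :|: W, forall u, phi (vgen u) = vgen u ^ g}.
Proof.
move=> J CC vNJ phiE.
have : {in U :|: W, forall u, u \in C \/ adj u v} \/
       {in U :|: W, forall u, u \notin C}.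
  (* Without triangles, [v] cannot have neighbours in both [U] and [W]. If it has one in [W], the
     two sides are exchanged. *)
  case: (boolP [exists w in W, adj v w]) => [/exists_inP[w Ww vw]|]; last first.
    rewrite negb_exists_in => /forall_inP vNW.
    exact: partial_conjugation_outside CC vNJ vNW.
  rewrite finset.setUC in vNJ *.
  apply: (partial_conjugation_outside (maximal_join_sym J) CC vNJ) => u Uu.
  have [[_ _ _ /(_ u w Uu Ww) uw] _] := J.
  by apply/negP=> vu; have := Gtf v u w; rewrite vu uw adj_sym vw.
case=> phiJ; [exists (vgen v) | exists 1] => u Ju; rewrite phiE.
  (* A vertex outside [C] is here adjacent to [v], so conjugation by [v] fixes it as well. *)
  by case: ifP => // uNC; case: (phiJ u Ju) => [|/vgen_adjJ ->]; rewrite ?uNC.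
by rewrite (negPf (phiJ u Ju)) conjg1.
Qed.

Lemma special_partial_conjugation U W S phi :
    maximal_join U W -> S = U :|: W \/ S = U -> partial_conjugation phi ->
  conjugate_sets (special S) (phi @` special S)%classic.
Proof.
move=> J SE [v [C [CC phiE]]].
have CD u := fintype.subsetP (component_sub CC) u.
have vNC : v \notin C by apply/negP=> /CD; rewrite !inE eqxx.
have [vJ|vNJ] := boolP (v \in U :|: W); last first.
  have [g phiJ] := partial_conjugation_outside_conj J CC vNJ phiE.
  apply: (@special_conj _ _ _ g) => u Su; apply: phiJ.
  by case: SE Su => -> //; rewrite inE => ->.
have [vS|vNS] := boolP (v \in S).
  apply: (special_multiplier vS); first by rewrite phiE (negPf vNC).
  by move=> u _; rewrite phiE; case: ifP => _; [constructor 2|constructor 1].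
have {SE} SU : S = U by case: SE vNS => // ->; rewrite vJ.
(* Now [v] lies in [W], so [U] is contained in [st v] and misses [C]. *)
rewrite {S}SU in vNS *; apply: special_fixed => u Uu; rewrite phiE; case: ifP => // /CD.
have [[_ _ _ UW] _] := J; rewrite !inE (negPf vNS) in vJ *.
by rewrite adj_sym UW ?orbT.
Qed.

Lemma transvection_multiplier U W v w :
    maximal_join U W -> lk w \subset st v -> w \in U ->
  v \in U \/ v \in W /\ leaf w.
Proof.
move=> J lkw Uw; have [[_ _ _ UW] _] := J.
have [vW|vNW] := boolP (v \in W); last first.
  left; apply: (maximal_join_absorb J) => x Wx.
  have /(fintype.subsetP lkw) : x \in lk w by rewrite inE UW.
  by rewrite !inE => /predU1P[xv|//]; rewrite -xv Wx in vNW.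
right; split=> //; apply/cards1P; exists v; apply/setP=> x; rewrite !inE.
apply/idP/eqP => [wx|->]; last exact: UW.
have /(fintype.subsetP lkw) : x \in lk w by rewrite inE.
rewrite !inE => /predU1P[//|vx].
by have := Gtf w v x; rewrite UW // vx adj_sym wx.
Qed.

Lemma special_transvection U W S phi :
    maximal_join U W ->
    S = U :|: W \/ S = U /\ {in U, forall u, ~~ leaf u} -> transvection phi ->
  conjugate_sets (special S) (phi @` special S)%classic.
Proof.
move=> J SE [v [w [vw lkw phiE]]].
have [wS|wNS] := boolP (w \in S); last first.
  apply: special_fixed => u Su; rewrite phiE; case: eqP => // uw.
  by rewrite -uw Su in wNS.
apply: (@special_multiplier _ _ _ v); last first.
- by move=> u _; rewrite phiE; case: eqP => [->|_]; [constructor 3|constructor 1].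
- by rewrite phiE (negPf vw).
case: SE wS => [->|[-> noleaf]] => [/setUP[wU|wW]|wU].
(* For the whole join either position of [v] is inside [S]; only for [S = U] must the leaf case be
   excluded. *)
- by case: (transvection_multiplier J lkw wU) => [|[]]; rewrite inE => ->; rewrite ?orbT.
- case: (transvection_multiplier (maximal_join_sym J) lkw wW) => [|[]];
    by rewrite inE => ->; rewrite ?orbT.
- case: (transvection_multiplier J lkw wU) => // -[_].
  by rewrite (negPf (noleaf w wU)).
Qed.

(** The set [S] stands for either the whole join or its leafless factor, so both claims of the
    theorem come from a single induction over generators. *)
Lemma special_pure U W S phi :
    maximal_join U W ->
    S = U :|: W \/ S = U /\ {in U, forall u, ~~ leaf u} -> pure_aut phi ->
  conjugate_sets (special S) (phi @` special S)%classic.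
Proof.
move=> J SE; move: phi; apply: generated_min.
  exact: is_subgroup_conj_stable.
move=> phi [[g phig]|inv|pc|tv] /=.
- by apply: (@special_conj _ _ _ g) => u _; apply: phig.
- exact: special_inversion.
- by apply: special_partial_conjugation J _ pc; case: SE => [|[]]; [left|right].
- exact: special_transvection J SE tv.
Qed.

End Joins.

Theorem proposition3p2 (G : sgraph) (Gconn : connected_graph G)
    (Gtf : triangle_free G) (Gedges : (2 <= #|edges G|)%N)
    (phi : aut (raag G)) (phi_pure : pure_aut phi)
    (U W : {set G}) (J : maximal_join U W) :
  conjugate_sets (special (U :|: W)%SET) (phi @` special (U :|: W)%SET)%classic /\
  ((forall u : G, u \in U -> ~~ leaf u) ->
   conjugate_sets (special U) (phi @` special U)%classic).
Proof.
split=> [|noleaf]; apply: (special_pure Gtf J) => //; [by left|by right].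
Qed.
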